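(* Let $\mathbf u$ be an infinite word over a finite alphabet whose language is closed under reversal. Then $D(\mathbf u)<+\infty$ if and only if $\sum_{n=0}^{+\infty}T_{\mathbf u}(n)<+\infty$.
   Context: For a finite word $w=w_0\cdots w_{n-1}$ its reversal is $\overline{w}=w_{n-1}\cdots w_0$; $w$ is a palindrome if $w=\overline{w}$ (the empty word is a palindrome). The language $\mathcal L(\mathbf u)$ is the set of all finite factors of $\mathbf u$, and $\mathcal L_n(\mathbf u)$ those of length $n$; the language is closed under reversal if $w\in\mathcal L(\mathbf u)$ implies $\overline w\in\mathcal L(\mathbf u)$. The factor complexity is $\mathcal C_{\mathbf u}(n)=\#\mathcal L_n(\mathbf u)$ and the palindromic complexity $\mathcal P_{\mathbf u}(n)$ is the number of palindromes in $\mathcal L_n(\mathbf u)$. Define $T_{\mathbf u}(n)=\mathcal C_{\mathbf u}(n+1)-\mathcal C_{\mathbf u}(n)+2-\mathcal P_{\mathbf u}(n+1)-\mathcal P_{\mathbf u}(n)$ (it is known that $T_{\mathbf u}(n)\ge 0$ for such words). The defect of a finite word $w$ is $D(w)=|w|+1-(\text{number of distinct palindromic factors of } w, \text{ including the empty word})$. The defect of an infinite word is $D(\mathbf u)=\sup\{D(w): w \text{ a prefix of } \mathbf u\}$ (possibly $+\infty$). *)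

(* Defs.v *)
From mathcomp Require Import all_boot.
From mathcomp Require Import boolp.
From mathcomp Require Import all_order ssralg ssrnum ssrint.
Import Order.TTheory GRing.Theory Num.Theory.
Set Implicit Arguments. Unset Strict Implicit. Unset Printing Implicit Defensive.

Section Words.
Variable A : finType.

Definition factor (u : nat -> A) (w : seq A) : Prop :=
  exists i, w = [seq u (i + j) | j <- iota 0 (size w)].

Definition closed_under_reversal (u : nat -> A) : Prop :=
  forall w : seq A, factor u w -> factor u (rev w).

Definition palindrome (w : seq A) : bool := rev w == w.

Definition fcompl (u : nat -> A) (n : nat) : nat :=
  #|[set t : n.-tuple A | `[< factor u t >]]|.

Definition pcompl (u : nat -> A) (n : nat) : nat :=
  #|[set t : n.-tuple A | `[< factor u t >] && palindrome t]|.

Definition Tu (u : nat -> A) (n : nat) : int :=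
  ((fcompl u n.+1)%:Z - (fcompl u n)%:Z + 2 - (pcompl u n.+1)%:Z
     - (pcompl u n)%:Z)%R.

Definition factors_of (w : seq A) : seq (seq A) :=
  [seq take j (drop i w) | i <- iota 0 (size w).+1, j <- iota 0 (size w - i).+1].

Definition npal (w : seq A) : nat :=
  size (undup [seq x <- factors_of w | palindrome x]).

Definition defect (w : seq A) : int := ((size w).+1%:Z - (npal w)%:Z)%R.

Definition prefix (u : nat -> A) (n : nat) : seq A := [seq u j | j <- iota 0 n].

(* D(u) < +oo : the sup of the defects of prefixes is finite *)
Definition finite_defect (u : nat -> A) : Prop :=
  exists B : int, forall n, (defect (prefix u n) <= B)%R.

(* sum_{n>=0} T_u(n) < +oo (as an absolutely convergent series of integers) *)
Definition T_summable (u : nat -> A) : Prop :=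
  exists B : int, forall N, (\sum_(0 <= n < N) `|Tu u n| <= B)%R.

End Words.

(* Main.v *)
Require Import Defs.
From mathcomp Require Import all_boot boolp all_order ssralg ssrnum ssrint.
From mathcomp Require Import zify.
Import Order.TTheory GRing.Theory Num.Theory.
Set Implicit Arguments. Unset Strict Implicit. Unset Printing Implicit Defensive.

(* Let G_n be the undirected graph whose vertices are the factors of length n
   up to reversal and whose edges are the non-palindromic factors of length
   n+1 up to reversal. It is connected because u walks through it, and
   T(n) / 2 = #edges - #vertices + 1. Hence T(n) >= 0, with equality iff G_n is
   a tree, and T is summable iff G_n is a tree for all large n. Likewise
   D(prefix of length m) counts the i < m such that reading the letter u_i
   creates no new palindrome, so D(u) is finite iff every letter far enough
   creates one.
   - If every letter at position >= n creates a new palindrome, a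
     non-palindromic edge of G_n traversed for the first time leads to a vertex
     visited for the first time, so G_n has at most #vertices - 1 edges.
   - If G_n is a tree for all n >= N, a walk in G_n returning to a vertex w
     comes back along the edge by which it left; iterating over n, the factor
     read between two consecutive visits to w (ends included) is a palindrome.
     Therefore the longest palindromic suffix of a long prefix of u has no
     earlier occurrence. *)

(** * Counting orbits of an involution *)

Section InvolutionWeight.
Variables (T : finType) (f : T -> T).
Hypothesis fK : involutive f.

(** A fixed point counts 2 and any other point 1, so each orbit in a closed set contributes 2. For
    factors of length n under reversal this is C(n) + P(n). *)
Definition weight (X : {set T}) := \sum_(x in X) (f x == x).+1.
Definition inv_closed (X : {set T}) := forall x, x \in X -> f x \in X.
Definition add_orbit x (X : {set T}) := x |: (f x |: X).

Lemma weightE (X : {set T}) : weight X = #|X| + #|[set x in X | f x == x]|.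
Proof.
rewrite /weight; under eq_bigr do rewrite -add1n.
rewrite big_split /= sum1_card; congr (_ + _).
rewrite -sum1_card big_mkcond [RHS]big_mkcond /=.
by apply: eq_bigr => x _; rewrite inE; case: (x \in X); case: (f x == x).
Qed.

Lemma weight_subset (X Y : {set T}) : X \subset Y -> weight X <= weight Y.
Proof.
move=> /subsetP XY; rewrite !weightE leq_add //.
  by apply/subset_leq_card/subsetP.
apply/subset_leq_card/subsetP => x; rewrite !inE => /andP[/XY -> ->]//.
Qed.

Lemma inv_closedE (X : {set T}) x : inv_closed X -> (f x \in X) = (x \in X).
Proof. by move=> cX; apply/idP/idP => /cX //; rewrite fK. Qed.

Lemma add_orbit_closed X x : inv_closed X -> inv_closed (add_orbit x X).
Proof.
move=> cX y; rewrite !inE => /orP[/eqP->|/orP[/eqP->|/cX ->]].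
- by rewrite eqxx orbT.
- by rewrite fK eqxx.
- by rewrite !orbT.
Qed.

Lemma weight_add_orbit X x :
  inv_closed X -> x \notin X -> weight (add_orbit x X) = (weight X).+2.
Proof.
move=> cX xX; have fxX : f x \notin X by rewrite inv_closedE.
rewrite /weight /add_orbit; case: (eqVneq (f x) x) => [fx|fx].
  by rewrite fx setUA setUid big_setU1 //= fx eqxx.
rewrite !big_setU1 //= ?fK; last by rewrite !inE negb_or eq_sym fx.
by rewrite (negPf fx) eq_sym (negPf fx).
Qed.

Lemma card_add_orbit (X : {set T}) x :
  f x != x -> x \notin X -> f x \notin X -> #|add_orbit x X| = #|X|.+2.
Proof.
by move=> fx xX fxX; rewrite !cardsU1 fxX !inE negb_or eq_sym fx xX.
Qed.

End InvolutionWeight.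

(** * Edge and vertex counts in the quotient graph *)

(* The quotient by reversal is an undirected graph: orbits of vertices are its
   vertices ([weight] counts each twice), and orbits of edges its
   edges, an edge fixed by [re] being a loop. *)
Section ReversibleGraph.
Variables (VT ET : finType) (rv : VT -> VT) (re : ET -> ET) (s t : ET -> VT).
Hypotheses (rvK : involutive rv) (reK : involutive re).
Hypothesis t_re : forall e, t (re e) = rv (s e).

Lemma s_re e : s (re e) = rv (t e).
Proof. by rewrite -{2}(reK e) t_re rvK. Qed.

(** A spanning tree is grown from one vertex orbit of weight 2: each edge leaving the current set X
    adds one vertex orbit to X and one two-element edge orbit to F. *)
Lemma connected_weight (V : {set VT}) (E : {set ET}) :
    inv_closed rv V -> inv_closed re E -> V != set0 ->
    (forall e, e \in E -> s e \in V /\ t e \in V) ->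
    (forall X : {set VT}, inv_closed rv X -> X \subset V -> X != set0 ->
      X != V -> exists2 e, e \in E & (s e \in X) != (t e \in X)) ->
  weight rv V <= #|[set e in E | re e != e]| + 2.
Proof.
move=> cV cE /set0Pn[x0 x0V] EV cut.
suff [X [F [cX XV X0 [FE FX wX [XeV|big]]]]] : exists (X : {set VT}) (F : {set ET}),
    [/\ inv_closed rv X, X \subset V, X != set0 &
     [/\ F \subset [set e in E | re e != e],
        (forall e, e \in F -> s e \in X /\ t e \in X),
        weight rv X <= #|F| + 2 & X = V \/ #|V| < #|X| ]].
- by rewrite -XeV; apply: leq_trans wX _; rewrite leq_add2r subset_leq_card.
- by have := subset_leq_card XV; rewrite leqNgt big.
(* The cardinal serves as fuel: k rounds leave X equal to V or with more than k elements. *)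
elim: #|V| => [|k [X [F [cX XV X0 [FE FX wX XVk]]]]].
  exists (add_orbit rv x0 set0), set0; split.
  - by apply: add_orbit_closed => // x; rewrite inE.
  - by apply/subsetP => x; rewrite !inE orbF => /orP[]/eqP-> //; apply: cV.
  - by apply/set0Pn; exists x0; rewrite !inE eqxx.
  split=> //; first exact: sub0set.
  - by move=> e; rewrite inE.
  - rewrite weight_add_orbit ?inE // ?/weight ?big_set0 ?cards0 //.
    by move=> x; rewrite inE.
  - by right; apply/card_gt0P; exists x0; rewrite !inE eqxx.
case: (eqVneq X V) => [XeV|XnV]; first by exists X, F; split => //; split=> //; left.
(* Up to reversal, a cut edge leaves X. *)
have [e eE [seX teX]] : exists2 e, e \in E & s e \in X /\ t e \notin X.
  have [e eE] := cut X cX XV X0 XnV.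
  case sX: (s e \in X); case tX: (t e \in X) => // _.
    by exists e; rewrite ?sX ?tX.
  exists (re e); first exact: cE.
  by rewrite s_re t_re !inv_closedE // sX tX.
have ren : re e != e.
  by apply: contra teX => /eqP <-; rewrite t_re inv_closedE.
have eF : e \notin F by apply: contra teX => /FX[].
have reF : re e \notin F.
  by apply: contra teX => /FX[]; rewrite s_re inv_closedE.
exists (add_orbit rv (t e) X), (add_orbit re e F); split.
- exact: add_orbit_closed.
- apply/subsetP => x; rewrite !inE => /orP[/eqP->|/orP[/eqP->|]].
  + by case: (EV e eE).
  + by apply: cV; case: (EV e eE).
  + exact: (subsetP XV).
- by apply/set0Pn; exists (t e); rewrite !inE eqxx.
split.
- apply/subsetP => x; rewrite !inE => /orP[/eqP->|/orP[/eqP->|]].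
  + by rewrite eE.
  + by rewrite cE // reK eq_sym.
  + by move/(subsetP FE); rewrite inE.
- move=> x; rewrite !inE => /orP[/eqP->|/orP[/eqP->|/FX[-> ->]]].
  + by rewrite seX eqxx !orbT.
  + by rewrite s_re t_re eqxx (cX _ seX) !orbT.
  + by rewrite !orbT.
- by rewrite weight_add_orbit // card_add_orbit // !addSn !ltnS.
right; case: XVk => [XeV|kX]; first by rewrite XeV eqxx in XnV.
apply: leq_ltn_trans kX (proper_card _); apply/properP; split.
  by apply/subsetP => x xX; rewrite !inE xX !orbT.
by exists (t e); rewrite // !inE eqxx.
Qed.

(** Along the walk, each new non-fixed edge orbit adds 2 to the cardinal of F and, by the last
    hypothesis, a new vertex orbit of weight 2 to X. The starting vertex accounts for the extra
    2. *)
Lemma walk_weight (V : {set VT}) (E : {set ET}) (p : nat -> ET) :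
    inv_closed rv V ->
    (forall k, s (p k.+1) = t (p k)) ->
    (forall k, s (p k) \in V) ->
    (forall e, e \in E -> exists k, e = p k) ->
    (forall k, re (p k) != p k ->
      (forall i, i < k -> p i != p k /\ p i != re (p k)) ->
      (forall i, i <= k -> s (p i) != t (p k) /\ s (p i) != rv (t (p k)))) ->
  #|[set e in E | re e != e]| + 2 <= weight rv V.
Proof.
move=> cV pS pV pE new.
have [K EK] : exists K, forall e, e \in E -> exists2 k, k < K & e = p k.
  have /choice [k kP] : forall e, exists k, e \in E -> e = p k.
    move=> e; case: (boolP (e \in E)) => [/pE[k ->]|_]; [by exists k|by exists 0].
  exists (\max_e k e).+1 => e /kP eE; exists (k e) => //.
  by rewrite ltnS leq_bigmax.
suff [X [F [cX cF XP FP wF]]] : exists (X : {set VT}) (F : {set ET}),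
    [/\ inv_closed rv X, inv_closed re F,
        (forall x, x \in X -> exists2 i, i <= K & x = s (p i) \/ x = rv (s (p i))),
        (forall i, i < K -> re (p i) != p i -> p i \in F) &
        #|F| + 2 <= weight rv X].
  apply: leq_trans (leq_trans wF _).
    rewrite leq_add2r subset_leq_card //; apply/subsetP => e; rewrite inE.
    by move=> /andP[/EK[k kK ->]]; apply: FP.
  by apply: weight_subset; apply/subsetP => x /XP[i _ [->|->]]; rewrite ?cV.
elim: K {EK} => [|k [X [F [cX cF XP FP wF]]]].
  have c0 : inv_closed rv set0 by move=> x; rewrite inE.
  exists (add_orbit rv (s (p 0)) set0), set0; split => //.
  - exact: add_orbit_closed.
  - by move=> x; rewrite inE.
  - by move=> x; rewrite !inE orbF => /orP[]/eqP ->; exists 0; auto.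
  - by rewrite weight_add_orbit ?inE // cards0.
have XP' x : x \in add_orbit rv (t (p k)) X ->
    exists2 i, i <= k.+1 & x = s (p i) \/ x = rv (s (p i)).
  rewrite !inE -pS => /orP[/eqP->|/orP[/eqP->|/XP[i ik Pi]]].
  - by exists k.+1; auto.
  - by exists k.+1; auto.
  - by exists i; rewrite // (leq_trans ik).
have [pF|[pF rep]] : (re (p k) != p k -> p k \in F) \/
    (p k \notin F /\ re (p k) != p k).
- by case: (p k \in F); case: (re (p k) != p k); auto.
- exists (add_orbit rv (t (p k)) X), F; split => //; first exact: add_orbit_closed.
    by move=> i; rewrite ltnS leq_eqVlt => /orP[/eqP -> //|]; apply: FP.
  apply: leq_trans wF (weight_subset _ _).
  by apply/subsetP => x xX; rewrite !inE xX !orbT.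
have repF : re (p k) \notin F by rewrite inv_closedE.
(* Non-fixed edges already walked lie in F, so [p k] is walked for the first time in either
   direction, and [new] keeps its end out of the visited orbits. *)
have tX : t (p k) \notin X.
  apply/negP => /XP[i ik tE].
  have fresh j : j < k -> p j != p k /\ p j != re (p k).
    move=> jk; split; apply/eqP => pj.
      by move: (FP _ jk); rewrite pj (negPf pF) => /(_ rep).
    by move: (FP _ jk); rewrite pj reK eq_sym (negPf repF) => /(_ rep).
  have [/eqP n1 /eqP n2] := new k rep fresh i ik.
  by case: tE => tE; [apply: n1|apply: n2; rewrite tE rvK].
exists (add_orbit rv (t (p k)) X), (add_orbit re (p k) F); split => //.
- exact: add_orbit_closed.
- exact: add_orbit_closed.
- move=> i; rewrite ltnS leq_eqVlt !inE => /orP[/eqP ->|ik /(FP _ ik) -> ].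
    by rewrite eqxx.
  by rewrite !orbT.
by rewrite weight_add_orbit // card_add_orbit // !addSn !ltnS.
Qed.

End ReversibleGraph.

(** * Bounded sums, discrete search and suffixes *)

Lemma bounded_sum_eventually0 (f : nat -> nat) B :
    (forall N, \sum_(0 <= n < N) f n <= B) ->
  exists N, forall n, N <= n -> f n = 0.
Proof.
move=> fB; apply: contrapT => noN.
have next N : exists2 n, N <= n & 0 < f n.
  apply: contrapT => no; apply: noN; exists N => n Nn.
  by case: (posnP (f n)) => // fn; case: no; exists n.
have big k : exists N, k <= \sum_(0 <= n < N) f n.
  elim: k => [|k [N kN]]; first by exists 0.
  have [n Nn fn] := next N; exists n.+1; rewrite big_nat_recr //=.
  rewrite -addn1 leq_add // (leq_trans kN) //.
  by rewrite (big_cat_nat (leq0n N) Nn) leq_addr.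
by have [N] := big B.+1; rewrite leqNgt ltnS fB.
Qed.

Lemma bool_change (g : nat -> bool) a b :
  a <= b -> g a != g b -> exists k, [/\ a <= k, k < b & g k != g k.+1].
Proof.
elim: b => [|b IH]; first by rewrite leqn0 => /eqP ->; rewrite eqxx.
rewrite leq_eqVlt => /orP[/eqP ->|]; first by rewrite eqxx.
rewrite ltnS => ab gab; case: (eqVneq (g a) (g b)) => [gE|/IH].
  by exists b; rewrite ab ltnSn -gE.
by move=> /(_ ab)[k [ak kb gk]]; exists k; rewrite ak (leqW kb).
Qed.

Lemma last_before (P : pred nat) k0 b :
    k0 < b -> P k0 ->
  exists k, [/\ k < b, P k & forall j, k < j -> j < b -> ~~ P j].
Proof.
move=> k0b Pk0.
have ex : exists k, (k < b) && P k by exists k0; rewrite k0b.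
have ub k : (k < b) && P k -> k <= b by case/andP => /ltnW.
case: (ex_maxnP ex ub) => k /andP[kb Pk] kmax; exists k; split=> // j kj jb.
by apply/negP => Pj; have := kmax j; rewrite jb Pj leqNgt kj => /(_ isT).
Qed.

Lemma suffix_comparable (T : eqType) (x y w : seq T) :
  suffix x w -> suffix y w -> size x <= size y -> suffix x y.
Proof.
move=> /suffixP[s ->] /suffixP[s' E] xy.
have sE : size s' <= size s.
  by move/(congr1 size): E; rewrite !size_cat; lia.
apply/suffixP; exists (drop (size s') s).
move/(congr1 (drop (size s'))): E.
rewrite (@drop_size_cat _ _ s') // drop_cat; case: ltnP => // ss' <-.
have -> : size s' = size s by lia.
by rewrite subnn drop0 drop_size.
Qed.

Lemma suffix_size_inj (T : eqType) (x y w : seq T) :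
  suffix x w -> suffix y w -> size x = size y -> x = y.
Proof.
move=> sx sy E; have := suffix_comparable sx sy; rewrite E leqnn => /(_ isT).
by rewrite suffixE E subnn drop0 => /eqP.
Qed.

(** * Palindromic factors of a finite word *)

Section FiniteWords.
Variable A : finType.
Implicit Types (w x y p : seq A) (a : A).

Lemma mem_factors_of w x : (x \in factors_of w) = infix x w.
Proof.
apply/idP/infixP => [/allpairsPdep[i [j [_ _ ->]]]|[s [s' ->]]].
  exists (take i w), (drop j (drop i w)).
  by rewrite !cat_take_drop.
apply/allpairsPdep; exists (size s), (size x); split.
- by rewrite mem_iota add0n ltnS size_cat /= leq_addr.
- by rewrite mem_iota add0n ltnS !size_cat addKn /= leq_addr.
- by rewrite drop_size_cat // take_size_cat.
Qed.

Definition palindromes_of w := undup [seq x <- factors_of w | palindrome x].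

Lemma mem_palindromes_of w x :
  (x \in palindromes_of w) = palindrome x && infix x w.
Proof. by rewrite mem_undup mem_filter mem_factors_of. Qed.

(** Reversing y turns its suffix x into a prefix; since x is shorter than y, that occurrence avoids
    the last letter. *)
Lemma infix_palindromic_suffix p a x y :
    palindrome x -> palindrome y -> suffix x y -> size x < size y ->
  suffix y (rcons p a) -> infix x p.
Proof.
move=> /eqP px /eqP py xy ltxy /suffixP[s pE].
have : prefix x y by rewrite -suffix_rev px py.
move=> /prefixP[z yE]; move: ltxy pE; rewrite {}yE.
case/lastP: z => [|z b _]; first by rewrite cats0 ltnn.
rewrite -!rcons_cat => /rcons_inj[-> _]; exact: infix_infix.
Qed.

Definition new_palindrome p a :=
  exists x, [/\ palindrome x, suffix x (rcons p a) & ~~ infix x p].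

(** One letter creates at most one palindrome: of two palindromic suffixes, the shorter already
    occurs in p. *)
Lemma npal_rcons p a :
  npal (rcons p a) = npal p + `[< new_palindrome p a >].
Proof.
have upal w : uniq (palindromes_of w) by apply: undup_uniq.
rewrite /npal -!/(palindromes_of _).
case: asboolP => [[x [px sx nx]]|old]; last first.
  rewrite addn0; apply/perm_size/uniq_perm => // y.
  rewrite !mem_palindromes_of infix_rconsl.
  case: (boolP (palindrome y)) => //= py; apply/orP/idP => [[sy|//]|]; last by right.
  by apply: contrapT => /negP ny; apply: old; exists y.
rewrite addn1.
have -> : (size (palindromes_of p)).+1 = size (x :: palindromes_of p) by [].
apply/perm_size/uniq_perm => //=.
  by rewrite upal mem_palindromes_of (negPf nx) andbF.
move=> y; rewrite inE !mem_palindromes_of infix_rconsl.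
case: (eqVneq y x) => [-> |yx]; first by rewrite px sx.
case: (boolP (palindrome y)) => //= py; apply/orP/idP => [[sy|//]|]; last by right.
have [lt_yx|] := ltnP (size y) (size x).
  have sub := suffix_comparable sy sx (ltnW lt_yx).
  exact: infix_palindromic_suffix py px sub lt_yx sx.
rewrite leq_eqVlt => /orP[/eqP eq_xy|lt_xy].
  by rewrite (suffix_size_inj sx sy eq_xy) eqxx in yx.
have sub := suffix_comparable sx sy (ltnW lt_xy).
by rewrite (infix_palindromic_suffix px py sub lt_xy sy) in nx.
Qed.

End FiniteWords.

(** * Occurrences in the infinite word and its defect *)

Section InfiniteWord.
Variables (A : finType) (u : nat -> A).

Definition window i n : seq A := [seq u (i + j) | j <- iota 0 n].

Arguments window : simpl never.

Lemma size_window i n : size (window i n) = n.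
Proof. by rewrite size_map size_iota. Qed.

Lemma nth_window x0 i n j : j < n -> nth x0 (window i n) j = u (i + j).
Proof. by move=> jn; rewrite (nth_map 0) ?size_iota // nth_iota. Qed.

Lemma factor_window i n : factor u (window i n).
Proof. by exists i; rewrite size_window. Qed.

Lemma windowSl i n : window i n.+1 = u i :: window i.+1 n.
Proof.
rewrite /window /= addn0; congr (_ :: _); rewrite (iotaDl 1 0) -map_comp.
by apply: eq_map => j /=; rewrite addnA addn1.
Qed.

Lemma windowSr i n : window i n.+1 = rcons (window i n) (u (i + n)).
Proof. by rewrite /window -addn1 iotaD map_cat /= cats1. Qed.

Lemma windowD i m n : window i (m + n) = window i m ++ window (i + m) n.
Proof.
elim: m i => [|m IH] i; first by rewrite addn0.
by rewrite addSn !windowSl IH /= addSnnS.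
Qed.

Lemma windowP i k n :
  (window i n = window k n) <-> (forall j, j < n -> u (i + j) = u (k + j)).
Proof.
split=> [E j jn|E]; first by rewrite -!(nth_window (u 0) _ jn) E.
apply: (@eq_from_nth _ (u 0)) => [|j]; rewrite !size_window // => jn.
by rewrite !nth_window // E.
Qed.

Lemma rev_windowP i k n :
  (rev (window i n) = window k n) <->
  (forall j, j < n -> u (i + (n - j.+1)) = u (k + j)).
Proof.
have nthE j : j < n -> nth (u 0) (rev (window i n)) j = u (i + (n - j.+1)).
  by move=> jn; rewrite nth_rev size_window // nth_window //; lia.
split=> [E j jn|E]; first by rewrite -nthE // E nth_window.
apply: (@eq_from_nth _ (u 0)) => [|j]; rewrite size_rev !size_window // => jn.
by rewrite nthE // E // nth_window.
Qed.

Lemma palindrome_windowP i n :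
  palindrome (window i n) <->
  (forall j, j < n -> u (i + (n - j.+1)) = u (i + j)).
Proof. by rewrite -rev_windowP; split => /eqP. Qed.

Lemma suffix_window (x : seq A) i n :
  suffix x (window i n) ->
  size x <= n /\ x = window (i + (n - size x)) (size x).
Proof.
move=> /suffixP[s E].
have nE : size s + size x = n by rewrite -size_cat -E size_window.
have -> : n - size x = size s by lia.
split; first by lia.
move: E; rewrite -nE windowD => /eqP; rewrite eqseq_cat ?size_window //.
by case/andP => _ /eqP.
Qed.

Lemma infix_windowP (x : seq A) i n :
  infix x (window i n) <->
  exists k, k + size x <= n /\ x = window (i + k) (size x).
Proof.
split=> [/infixP[s [s' E]]|[k [kn ->]]].
  have nE : size s + (size x + size s') = n by rewrite -!size_cat -E size_window.
  exists (size s); split; first by lia.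
  move: E; rewrite -nE !windowD => /eqP.
  by rewrite eqseq_cat ?size_window // eqseq_cat ?size_window // => /and3P[_ /eqP].
have -> : n = k + (size x + (n - (k + size x))) by lia.
by rewrite !windowD infix_infix.
Qed.

Definition new_palindrome_at m := new_palindrome (window 0 m) (u m).

(** Here [a] is the start of the new palindromic suffix; an occurrence of it inside the prefix of
    length m is one starting before [a]. *)
Lemma new_palindrome_atP m :
  new_palindrome_at m <->
  exists a, [/\ a <= m.+1, palindrome (window a (m.+1 - a)) &
    forall k, k < a -> window k (m.+1 - a) <> window a (m.+1 - a)].
Proof.
rewrite /new_palindrome_at /new_palindrome -[u m]/(u (0 + m)) -windowSr; split.
  move=> [x [px sx nx]]; have [xm xE] := suffix_window sx.
  exists (m.+1 - size x); rewrite leq_subr subKn //; split=> //.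
    by rewrite -[_ - _]add0n -xE.
  move=> k km E; move/negP: nx; apply; apply/infix_windowP; exists k.
  by split; [lia|rewrite add0n E xE size_window].
move=> [a [am pa na]]; exists (window a (m.+1 - a)); split=> //.
  by rewrite -{2}(subnKC am) windowD suffix_suffix.
apply/negP => /infix_windowP[k [km /esym E]].
rewrite size_window add0n in km E; apply: na E; lia.
Qed.

(** The empty prefix holds one palindrome, the empty word; each further letter adds either a
    palindrome or a unit of defect. *)
Lemma npal_prefix m :
  npal (Defs.prefix u m) + \sum_(0 <= i < m) ~~ `[< new_palindrome_at i >] = m.+1.
Proof.
elim: m => [|m IH]; first by rewrite big_geq.
rewrite big_nat_recr //= -[Defs.prefix _ _]/(window 0 m.+1) windowSr npal_rcons.
rewrite -[new_palindrome _ _]/(new_palindrome_at m).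
rewrite -[window 0 m]/(Defs.prefix u m); case: asboolP => _ /=; lia.
Qed.

Lemma defect_prefix m :
  defect (Defs.prefix u m) =
  Posz (\sum_(0 <= i < m) ~~ `[< new_palindrome_at i >]).
Proof.
rewrite /defect size_map size_iota -(npal_prefix m); lia.
Qed.

Lemma finite_defectP :
  finite_defect u <-> exists M, forall m, M <= m -> new_palindrome_at m.
Proof.
split=> [[B DB]|[M newM]].
  have [|M M0] := @bounded_sum_eventually0
      (fun i => ~~ `[< new_palindrome_at i >]) `|B|%N.
    by move=> N; have := DB N; rewrite defect_prefix; lia.
  by exists M => m /M0; case: asboolP.
exists (Posz M) => n; rewrite defect_prefix lez_nat.
(* Only positions below M can fail, each costing at most 1. *)
apply: (@leq_trans (\sum_(0 <= i < n) (i < M))).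
  by apply: leq_sum => i _; case: ltnP => [_|/newM /asboolP -> //]; apply: leq_b1.
elim: n => [|n IH]; first by rewrite big_geq.
have [nM|Mn] := ltnP n M; last by rewrite big_nat_recr //= ltnNge Mn addn0.
apply: (@leq_trans (\sum_(0 <= i < n.+1) 1)).
  by apply: leq_sum => i _; apply: leq_b1.
by rewrite sum_nat_const_nat; lia.
Qed.

End InfiniteWord.

Arguments window : simpl never.

(** * Rauzy graphs up to reversal and the sign of T *)

Section RauzyGraph.
Variables (A : finType) (u : nat -> A).
Hypothesis u_closed : closed_under_reversal u.
Local Notation win := (window u).

Definition trev n (w : n.-tuple A) : n.-tuple A := [tuple of rev w].
Definition target n (e : n.+1.-tuple A) : n.-tuple A := [tuple of behead e].
(** This drops the last letter; conjugating [target] by reversal makes the ends compatible with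
    reversal at once. *)
Definition source n (e : n.+1.-tuple A) : n.-tuple A :=
  trev (target (trev e)).

Lemma trevK n : involutive (@trev n).
Proof. by move=> w; apply: val_inj; rewrite /= revK. Qed.

Lemma target_trev n (e : n.+1.-tuple A) : target (trev e) = trev (source e).
Proof. by rewrite trevK. Qed.

Lemma source_trev n (e : n.+1.-tuple A) : source (trev e) = trev (target e).
Proof. by rewrite /source trevK. Qed.

Definition twindow i n : n.-tuple A := Tuple (introT eqP (size_window u i n)).

Lemma target_twindow i n : target (twindow i n.+1) = twindow i.+1 n.
Proof. by apply: val_inj; exact: (congr1 behead (windowSl u i n)). Qed.

Lemma source_twindow i n : source (twindow i n.+1) = twindow i n.
Proof.
apply: val_inj; change (rev (behead (rev (win i n.+1))) = win i n).
by rewrite windowSr rev_rcons revK.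
Qed.

Definition language n : {set n.-tuple A} := [set w : n.-tuple A | `[< factor u w >]].

Lemma languageP n (w : n.-tuple A) :
  reflect (exists i, w = twindow i n) (w \in language n).
Proof.
rewrite inE; apply: (iffP (asboolP _)) => [[i]|[i ->]].
  by rewrite size_tuple => wE; exists i; apply: val_inj.
exact: factor_window.
Qed.

Lemma twindow_language i n : twindow i n \in language n.
Proof. by apply/languageP; exists i. Qed.

Lemma language_closed n : inv_closed (@trev n) (language n).
Proof. by move=> w; rewrite !inE => /asboolP /u_closed ?; apply/asboolP. Qed.

Definition nonpal n := [set e in language n | trev e != e].

(** C(n+1) - P(n+1) counts the non-palindromic edges, and C(n) + P(n) is the weight of the
    vertices. *)
Lemma Tu_weight n :
  Tu u n = (Posz #|nonpal n.+1| + 2 - Posz (weight (@trev n) (language n)))%R.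
Proof.
have palE m : pcompl u m = #|[set w in language m | trev w == w]|.
  by apply: eq_card => w; rewrite !inE.
have -> : #|nonpal n.+1| = fcompl u n.+1 - pcompl u n.+1.
  rewrite palE -[fcompl _ _]/#|language n.+1|.
  rewrite -(cardsID [set w | trev w == w] (language n.+1)).
  have -> : language n.+1 :&: [set w | trev w == w] =
            [set w in language n.+1 | trev w == w].
    by apply/setP => w; rewrite !inE.
  by rewrite addKn; apply: eq_card => w; rewrite !inE andbC.
have leP : pcompl u n.+1 <= fcompl u n.+1.
  by rewrite palE; apply/subset_leq_card/subsetP => w; rewrite inE => /andP[].
rewrite weightE -palE -[#|language n|]/(fcompl u n) /Tu; lia.
Qed.

(* [u] is a walk through all vertices, so it crosses every cut. *)
Lemma language_crossing n (X : {set n.-tuple A}) :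
    X \subset language n -> X != set0 -> X != language n ->
  exists k, (twindow k n \in X) != (twindow k.+1 n \in X).
Proof.
move=> XL /set0Pn[x xX] XnL.
have /subsetPn[y yL yX] : ~~ (language n \subset X).
  by apply: contra XnL => LX; rewrite eqEsubset XL.
have /languageP[i xE] := subsetP XL x xX; have /languageP[j yE] := yL.
pose g k := twindow k n \in X.
have gij : g i != g j by rewrite /g -xE -yE xX (negPf yX).
have [ij|/ltnW ji] := leqP i j.
  by have [k [_ _ gk]] := bool_change ij gij; exists k.
by rewrite eq_sym in gij; have [k [_ _ gk]] := bool_change ji gij; exists k.
Qed.

Lemma language_neq0 n : language n != set0.
Proof. by apply/set0Pn; exists (twindow 0 n); apply: twindow_language. Qed.

Lemma edge_ends n (e : n.+1.-tuple A) :
  e \in language n.+1 -> source e \in language n /\ target e \in language n.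
Proof.
by move=> /languageP[i ->]; rewrite source_twindow target_twindow !twindow_language.
Qed.

Lemma Tu_ge0 n : (0 <= Tu u n)%R.
Proof.
rewrite Tu_weight.
suff : weight (@trev n) (language n) <= #|nonpal n.+1| + 2 by lia.
apply: (connected_weight (@trevK n) (@trevK n.+1) (@target_trev n)).
- exact: language_closed.
- exact: language_closed.
- exact: language_neq0.
- exact: edge_ends.
move=> X cX XL X0 XnL; have [k kX] := language_crossing XL X0 XnL.
exists (twindow k n.+1); first exact: twindow_language.
by rewrite source_twindow target_twindow.
Qed.

(** The letter at position k + n ends the k-th edge, so the palindrome it creates is a suffix of
    that edge or extends it to the left. *)
Lemma Tu_le0 n :
  (forall m, n <= m -> new_palindrome_at u m) -> (Tu u n <= 0)%R.
Proof.
move=> new; rewrite Tu_weight.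
suff : #|nonpal n.+1| + 2 <= weight (@trev n) (language n) by lia.
apply: (@walk_weight _ _ (@trev n) (@trev n.+1) (@source n) (@target n)
          (@trevK n) (@trevK n.+1) _ _ (fun k => twindow k n.+1)).
- exact: language_closed.
- by move=> k; rewrite source_twindow target_twindow.
- by move=> k; rewrite source_twindow twindow_language.
- by move=> e /languageP.
move=> k npal fresh i ik; rewrite source_twindow target_twindow.
have /new_palindrome_atP[a [am pa na]] := new (k + n) (leq_addl _ _).
move/palindrome_windowP: pa => pa.
(* If a > k, the palindrome is a suffix of the end vertex, and an earlier visit to it, direct or
   reversed, would contain an earlier copy. Otherwise the palindrome mirrors the edge to position a:
   the edge is a palindrome or was walked before. *)
have [ka|ak] := ltnP k a.
  split; apply/eqP => /(congr1 val) /= /esym E.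
    apply: (na (i + (a - k.+1))); first by lia.
    apply/windowP => j jn; move/windowP: E => /(_ (a - k.+1 + j)) E.
    have -> : a + j = k.+1 + (a - k.+1 + j) by lia.
    by rewrite E ?addnA //; lia.
  apply: (na i); first by lia.
  apply/windowP => j jn; move/rev_windowP: E => /(_ j) <-; last by lia.
  by rewrite -pa //; congr u; lia.
have E : trev (twindow k n.+1) = twindow a n.+1.
  apply: val_inj; apply/rev_windowP => j jn; rewrite -pa; last by lia.
  by congr u; lia.
move: ak; rewrite leq_eqVlt => /orP[/eqP ak|/fresh[_]].
  by move: npal; rewrite E ak eqxx.
by rewrite E eqxx.
Qed.

(** * Palindromic returns when T vanishes *)

Definition same_orbit i j n :=
  (win j n == win i n) || (win j n == rev (win i n)).

(* When [T n = 0] the quotient graph is a tree up to palindromic loops, so a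
   walk leaving a vertex comes back to it along the edge it left by. *)
Lemma tree_return n i d :
    Tu u n = 0%R -> 0 < d -> same_orbit i (i + d) n ->
    (forall j, 0 < j -> j < d -> ~~ same_orbit i (i + j) n) ->
  win (i + d.-1) n.+1 = rev (win i n.+1).
Proof.
move=> T0 d0 ret noret; apply: contrapT => ne_last.
pose e := twindow i n.+1.
(* A palindromic first edge leads straight to the reversed vertex, so d = 1 and the claim holds. *)
have npal_e : trev e != e.
  apply/eqP => /(congr1 val)/= E.
  have d1 : d = 1.
    apply: contrapT => d1; have lt1d : 1 < d by lia.
    have/negP := noret 1 isT lt1d; apply.
    move: E; rewrite {1}windowSr {1}windowSl rev_rcons addn1 => -[_ E].
    by apply/orP; right; rewrite E.
  by apply: ne_last; rewrite E d1 addn0.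
(* If the graph stayed connected without this edge, the vertices would weigh at most
   [#|nonpal n.+1|], while T(n) = 0 makes that weight 2 larger. *)
pose E := language n.+1 :\: [set e; trev e].
have cE : inv_closed (@trev n.+1) E.
  move=> f; rewrite 4!inE negb_or => /andP[/andP[f1 f2] fL].
  rewrite in_setD language_closed // !inE negb_or andbT.
  by rewrite (inv_eq (@trevK _)) f2 (inj_eq (can_inj (@trevK _))).
have := @connected_weight _ _ _ _ _ _ (@trevK n) (@trevK n.+1) (@target_trev n)
  (language n) E (language_closed (n:=n)) cE (language_neq0 n).
have cardE : #|[set f in E | trev f != f]| + 2 = #|nonpal n.+1|.
  have -> : [set f in E | trev f != f] = nonpal n.+1 :\: [set e; trev e].
    by apply/setP => f; rewrite !inE andbA.
  have sub : [set e; trev e] \subset nonpal n.+1.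
    apply/subsetP => f; rewrite !inE => /orP[]/eqP ->; apply/andP; split=> //.
    - by apply/asboolP/factor_window.
    - by apply/asboolP/u_closed/factor_window.
    - by rewrite trevK eq_sym.
  have c2 : #|[set e; trev e]| = 2 by rewrite cards2 eq_sym npal_e.
  by rewrite cardsDS // c2 subnK // -c2 subset_leq_card.
rewrite cardE => C; move: T0; rewrite Tu_weight.
suff : weight (@trev n) (language n) <= #|nonpal n.+1| by lia.
apply: C; first by move=> f; rewrite inE => /andP[_]; apply: edge_ends.
move=> X cX XL X0 XnL; have [k kX] := language_crossing XL X0 XnL.
have crossing m : twindow m n.+1 \in E ->
    (twindow m n \in X) != (twindow m.+1 n \in X) ->
    exists2 f, f \in E & (source f \in X) != (target f \in X).
  by exists (twindow m n.+1); rewrite // source_twindow target_twindow.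
have [|kE] := boolP (twindow k n.+1 \in E); first by move=> /crossing; apply.
have orbit_X a b : same_orbit a b n -> (twindow b n \in X) = (twindow a n \in X).
  case/orP => /eqP H.
    by have -> : twindow b n = twindow a n by apply: val_inj.
  have -> : twindow b n = trev (twindow a n) by apply: val_inj.
  by rewrite (inv_closedE (@trevK n)).
have iX : (twindow i n \in X) != (twindow i.+1 n \in X).
  move: kE; rewrite in_setD twindow_language andbT negbK !inE => /orP[]/eqP kE.
    by rewrite -source_twindow -target_twindow -/e -kE source_twindow target_twindow.
  move: kX; rewrite -source_twindow -target_twindow kE target_trev.
  rewrite source_trev 2!(inv_closedE (@trevK n) _ cX) /e.
  rewrite source_twindow target_twindow.
  by rewrite eq_sym.
(* The first edge crosses the cut and the walk ends in its initial orbit, so it crosses back at some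
   later l. *)
have := @bool_change (fun k => twindow k n \in X) i.+1 (i + d).
rewrite /= (orbit_X i (i + d)) // eq_sym => /(_ _ iX)[|l [il lid lX]].
  by clear -d0; lia.
have [il' ld] : i <= l /\ l - i < d by clear -il lid; lia.
apply: (crossing l) => //; rewrite in_setD twindow_language andbT !inE negb_or.
(* The first edge at l would revisit the vertex at l; its reversal would do so at l + 1, unless the
   walk ends there, which [ne_last] excludes. *)
apply/andP; split; apply/eqP => /(congr1 val)/= lE.
  have := noret (l - i).
  rewrite subn_gt0 subnKC // => /(_ il ld)/negP; apply.
  apply/orP; left; apply/eqP.
  by move: lE; rewrite 2!windowSr => /rcons_inj[].
have [ll|ll] := ltnP l.+1 (i + d).
  have lSd : l.+1 - i < d by clear -il' ll; lia.
  have := noret (l.+1 - i).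
  rewrite subn_gt0 subnKC; last exact: leqW.
  move=> /(_ il' lSd)/negP; apply; apply/orP; right; apply/eqP.
  by move: lE; rewrite windowSl (windowSr _ i) rev_rcons => -[].
have lE' : i + d.-1 = l by clear -il lid ll; lia.
by apply: ne_last; rewrite lE' lE.
Qed.

(** Since the return edge reverses the first one, a first return after d steps at length n is one
    after d - 1 steps at length n + 1. The sum n + d is kept, and d = 1 gives a palindromic edge. *)
Lemma palindromic_return N n i d :
    (forall m, N <= m -> Tu u m = 0%R) -> N <= n -> 0 < d ->
    same_orbit i (i + d) n ->
    (forall j, 0 < j -> j < d -> ~~ same_orbit i (i + j) n) ->
  palindrome (win i (n + d)).
Proof.
move=> T0; elim: d n => // d IH n Nn _ ret noret.
have /= last_edge := tree_return (T0 n Nn) (ltn0Sn d) ret noret.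
case: (posnP d) => [d0|d_gt0].
  by move: last_edge; rewrite d0 addn0 addn1 => E; apply/eqP.
rewrite addnS -addSn; apply: IH => //; first exact: leqW.
  by apply/orP; right; apply/eqP.
move=> j j0 jd; apply/negP => /orP[]/eqP E.
  have/negP := noret j j0 (leqW jd); apply; apply/orP; left; apply/eqP.
  by move: E; rewrite !windowSr => /rcons_inj[].
have/negP := noret j.+1 isT jd; apply; apply/orP; right; apply/eqP.
by move: E; rewrite windowSl (windowSr _ i) rev_rcons addnS => -[].
Qed.

Lemma factors_occur_early n :
  exists K, forall i, exists2 k, k < K & win k n = win i n.
Proof.
have /choice [f fP] : forall w : n.-tuple A,
    exists k, w \in language n -> w = twindow k n.
  move=> w; case: (boolP (w \in language n)) => [/languageP[k ->]|_].
    by exists k.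
  by exists 0.
exists (\max_w f w).+1 => i; exists (f (twindow i n)).
  by rewrite ltnS leq_bigmax.
by have /(congr1 val) := fP _ (twindow_language i n).
Qed.

(** The longest palindromic suffix is new: the stretch from its last earlier visit, up to reversal,
    would be a longer one. A suffix shorter than N is replaced by the suffix of length N. *)
Lemma eventually_new_palindrome N :
    (forall m, N <= m -> Tu u m = 0%R) ->
  exists M, forall m, M <= m -> new_palindrome_at u m.
Proof.
move=> T0; have [K early] := factors_occur_early N.
(* This bound places the suffix of length N beyond K, so it has an earlier occurrence. *)
exists (K + N) => m KNm; apply/new_palindrome_atP.
have ex_a : exists a, (a <= m.+1) && palindrome (win a (m.+1 - a)).
  by exists m.+1; rewrite leqnn subnn.
case: (ex_minnP ex_a) => a /andP[am pa] amin.
exists a; split => // k0 k0a E0.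
(* Here b is the start of the suffix of length n; a return to it yields a palindromic suffix
   starting before a. *)
have longer n b k1 : N <= n -> n <= m.+1 -> b = m.+1 - n -> b <= a -> k1 < b ->
    same_orbit b k1 n -> False.
  move=> Nn nm bE ba k1b orb.
  have [k [kb orb_k last_k]] :=
    @last_before (fun k => same_orbit b k n) k1 b k1b orb.
  have: palindrome (win k (n + (b - k))).
    apply: (palindromic_return T0 Nn); first by lia.
      rewrite subnKC; last by lia.
      by case/orP: orb_k => /eqP E; rewrite /same_orbit E ?revK eqxx ?orbT.
    move=> j j0 jb; apply: contra (last_k (k + j) _ _); try lia.
    by case/orP: orb_k => /eqP E; rewrite /same_orbit E ?revK // orbC.
  have -> : n + (b - k) = m.+1 - k by lia.
  move=> pk; have := amin k; rewrite pk andbT => /(_ _); lia.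
have [Nn|nN] := leqP N (m.+1 - a).
  apply: (longer (m.+1 - a) a k0) => //; try lia.
  by apply/orP; left; apply/eqP.
have [k1 k1K E1] := early (m.+1 - N).
apply: (longer N (m.+1 - N) k1) => //; try lia.
by apply/orP; left; apply/eqP.
Qed.

End RauzyGraph.

(** * Equivalence of the two finiteness conditions *)

Theorem theorem2 (A : finType) (u : nat -> A) :
  closed_under_reversal u -> (finite_defect u <-> T_summable u).
Proof.
move=> u_closed; rewrite finite_defectP; split=> [[M newM]|[B TB]].
  have T0 n : M <= n -> Tu u n = 0%R.
    move=> Mn; apply/eqP; rewrite eq_le Tu_ge0 // andbT; apply: Tu_le0 => // m nm.
    exact: newM (leq_trans Mn nm).
  exists (\sum_(0 <= n < M) `|Tu u n|)%R => N.
  have [NM|/ltnW MN] := leqP N M.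
    by rewrite (big_cat_nat (leq0n N) NM) /= lerDl sumr_ge0.
  rewrite (big_cat_nat (leq0n M) MN) /= gerDl big_nat big1 // => n /andP[Mn _].
  by rewrite T0.
have [|N TN] := @bounded_sum_eventually0 (fun n => `|Tu u n|%N) `|B|%N.
  move=> N; have : (Posz (\sum_(0 <= n < N) `|Tu u n|%N) <= B)%R.
    by rewrite (big_morph Posz PoszD (erefl _)); exact: TB.
  lia.
by apply: (eventually_new_palindrome u_closed (N := N)) => m /TN; lia.
Qed.
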